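(* Let $m,r$ be real numbers with $m\neq 0$. For all integers $\ell,n\ge 0$ and all real numbers $x,y$, $$D_{m,r}(\ell+n;x,y)=\sum_{k=0}^{\ell}\sum_{i=0}^n(mk)^{n-i}\binom{n}{i}W_{m,r}(\ell,k)\,D_{m,r}(i;x-k,y)\,(x)_k\,y^k,$$ and $$D_{m,r}(\ell+n)=\sum_{k=0}^{\ell}\sum_{i=0}^n(mk)^{n-i}\binom{n}{i}W_{m,r}(\ell,k)\,D_{m,r}(i).$$
   Context: Falling factorial: $(x)_0=1$ and $(x)_k=x(x-1)\cdots(x-k+1)$ for $k\ge1$. For real $m\neq0$ and real $r$, the $r$-Whitney numbers of the second kind $W_{m,r}(n,k)$, $0\le k\le n$, are defined by the polynomial identity in $t$ $$(mt+r)^n=\sum_{k=0}^n m^kW_{m,r}(n,k)(t)_k .$$ The bivariate $r$-Dowling polynomials are $D_{m,r}(n;x,y)=\sum_{k=0}^nW_{m,r}(n,k)(x)_ky^k$. The $r$-Dowling numbers are $D_{m,r}(n)=\sum_{k=0}^nW_{m,r}(n,k)$. The convention $0^0=1$ is used. *)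

(* Defs.v *)
(* MathComp, over an arbitrary R : realType; 0 ^+ 0 = 1 in MathComp. *)
From mathcomp Require Import all_boot all_order all_algebra.
From mathcomp Require Import reals ring.

Set Implicit Arguments.
Unset Strict Implicit.
Unset Printing Implicit Defensive.

Import GRing.Theory.
Local Open Scope ring_scope.

(* Over a general commutative ring, so as to apply both to numbers and to
   the polynomial indeterminate. *)
Definition falling (A : comNzRingType) (x : A) (k : nat) : A :=
  \prod_(i < k) (x - i%:R).

(* W n k is the r-Whitney number of the second kind W_{m,r}(n, k), for
   k <= n; the identity is in {poly R}, and the values W n k with n < k are
   unconstrained. *)
Definition is_rWhitney2 (R : realType) (m r : R) (W : nat -> nat -> R) : Prop :=
  forall n : nat,
    (m *: 'X + r%:P) ^+ n
      = \sum_(k < n.+1) (m ^+ k * W n k) *: falling ('X : {poly R}) k.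

Definition rDowling_poly (R : realType) (W : nat -> nat -> R) (n : nat)
    (x y : R) : R :=
  \sum_(k < n.+1) W n k * falling x k * y ^+ k.

Definition rDowling (R : realType) (W : nat -> nat -> R) (n : nat) : R :=
  \sum_(k < n.+1) W n k.

(* When m != 0 the identities above are satisfied by exactly one family of
   numbers W n k, k <= n (the lemmas is_rWhitney2_exists, is_rWhitney2_unique). *)

Lemma fallingS (A : comNzRingType) (x : A) k :
  falling x k.+1 = falling x k * (x - k%:R).
Proof. by rewrite /falling big_ord_recr. Qed.

Fixpoint rWhitney2_rec (R : realType) (m r : R) (n k : nat) : R :=
  match n with
  | 0 => (k == 0)%:R
  | n'.+1 => (if k is k'.+1 then rWhitney2_rec m r n' k' else 0)
             + (m * k%:R + r) * rWhitney2_rec m r n' k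
  end.

Lemma rWhitney2_rec_gt (R : realType) (m r : R) n k :
  (n < k)%N -> rWhitney2_rec m r n k = 0.
Proof.
elim: n k => [|n IH] [|k] //= lt_nk.
by rewrite !IH ?mulr0 ?addr0 // ltnW.
Qed.

Lemma is_rWhitney2_exists (R : realType) (m r : R) :
  is_rWhitney2 m r (rWhitney2_rec m r).
Proof.
elim=> [|n IH].
  by rewrite big_ord1 /= /falling big_ord0 expr0 mul1r scale1r.
rewrite exprSr IH mulr_suml.
pose F k := (m ^+ k.+1 * rWhitney2_rec m r n k) *: falling ('X : {poly R}) k.+1.
pose G k := (m ^+ k * ((m * k%:R + r) * rWhitney2_rec m r n k))
              *: falling ('X : {poly R}) k.
transitivity (\sum_(k < n.+1) F k + \sum_(k < n.+1) G k).
  rewrite -big_split; apply: eq_bigr => k _; rewrite /F /G fallingS /=.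
  move: (falling _ _) (rWhitney2_rec _ _ _ _) => f w.
  rewrite -!mul_polyC !(polyCM, polyCD, polyC_exp) polyC_natr exprSr.
  move: (m%:P) (r%:P) (w%:P) => a b c.
  by ring.
rewrite [RHS]big_ord_recl /=.
rewrite [X in _ = _ + X](eq_bigr (fun k : 'I_n.+1 => F k + G k.+1)); last first.
  by move=> k _; rewrite /F /G -scalerDl -mulrDr.
rewrite big_split /= add0r addrCA; congr (_ + _).
rewrite -[X in X + _]/(G 0%N) -(big_ord_recl n.+1 (fun k : 'I_n.+2 => G k)) /=.
by rewrite [RHS]big_ord_recr /= /G (rWhitney2_rec_gt _ _ (ltnSn n)) !mulr0 scale0r addr0.
Qed.

Lemma size_falling_X (R : realType) k :
  size (falling ('X : {poly R}) k) = k.+1.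
Proof.
rewrite /falling (eq_bigr (fun i : 'I_k => 'X - (i%:R : R)%:P)).
  by rewrite size_prod_XsubC [index_enum _]unlock -enumT size_enum_ord.
by move=> i _; rewrite polyC_natr.
Qed.

Lemma falling_X_free (R : realType) n (c : nat -> R) :
    \sum_(k < n) c k *: falling ('X : {poly R}) k = 0 ->
  forall k, (k < n)%N -> c k = 0.
Proof.
elim: n => // n IH; rewrite big_ord_recr /= => sum0.
have cn0 : c n = 0.
  apply/eqP; apply: contraT => cn_neq0.
  have : (size (\sum_(k < n) c k *: falling ('X : {poly R}) k)%R
          < size (c n *: falling ('X : {poly R}) n)%R)%N.
    rewrite size_scale // size_falling_X ltnS.
    apply: leq_trans (size_sum _ _ _) _; apply/bigmax_leqP => k _.
    by apply: leq_trans (size_scale_leq _ _) _; rewrite size_falling_X.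
  by move=> lt_sz; have := size_polyDl lt_sz; rewrite addrC sum0 size_poly0 size_scale // size_falling_X.
move: sum0; rewrite cn0 scale0r addr0 => /IH c0 k.
by rewrite ltnS leq_eqVlt => /predU1P[-> // | /c0].
Qed.

Lemma is_rWhitney2_unique (R : realType) (m r : R) (W W' : nat -> nat -> R) :
    m != 0 -> is_rWhitney2 m r W -> is_rWhitney2 m r W' ->
  forall n k, (k <= n)%N -> W n k = W' n k.
Proof.
move=> m_neq0 hW hW' n k le_kn.
have sum0 : \sum_(k < n.+1) (m ^+ k * W n k - m ^+ k * W' n k)
              *: falling ('X : {poly R}) k = 0.
  under eq_bigr do rewrite scalerBl.
  by rewrite sumrB -hW -hW' subrr.
have /eqP := falling_X_free (c := fun k => m ^+ k * W n k - m ^+ k * W' n k)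
  sum0 le_kn.
by rewrite -mulrBr mulf_eq0 expf_eq0 (negPf m_neq0) andbF subr_eq0 => /eqP.
Qed.

(* Main.v *)
(* Pair the coefficients W n k with an arbitrary sequence b.  The recurrence of
   the Whitney numbers says that \sum_k W n k * b k is the value at 0 of
   T^n b, where (T b) k = b k.+1 + (m * k + r) * b k.  If S_k is the shift by k
   then S_k T = (T + m * k) S_k, whence S_k T^n = (T + m * k)^n S_k; expanding
   by the binomial theorem in T^l (T^n b) gives one identity for all b, and the
   two claims are b k = (x)_k y^k and b k = 1. *)
Require Import Defs.
From mathcomp Require Import all_boot all_order all_algebra.
From mathcomp Require Import reals ring.

Set Implicit Arguments.
Unset Strict Implicit.
Unset Printing Implicit Defensive.

Import GRing.Theory.
Local Open Scope ring_scope.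

Lemma falling_add (A : comNzRingType) (x : A) k j :
  falling x (k + j) = falling x k * falling (x - k%:R) j.
Proof.
rewrite /falling big_split_ord /=; congr (_ * _).
by apply: eq_bigr => i _; rewrite natrD opprD addrA.
Qed.

(** Pascal's rule: with [E] the index shift on [u], this is [(E + a)^(n+1) = (E + a)^n (E + a)]
    applied to [u] and read at index 0. *)
Lemma binomial_sumS (A : comNzRingType) (a : A) (u : nat -> A) n :
  \sum_(i < n.+2) a ^+ (n.+1 - i) * 'C(n.+1, i)%:R * u i
  = \sum_(i < n.+1) a ^+ (n - i) * 'C(n, i)%:R * (u i.+1 + a * u i).
Proof.
under [RHS]eq_bigr do rewrite mulrDr.
rewrite big_split /= big_ord_recl /=.
under eq_bigr => i _.
  rewrite /bump leq0n add1n subSS binS natrD mulrDr mulrDl.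
over.
rewrite big_split /= addrA addrC; congr (_ + _).
rewrite big_ord_recr /= (bin_small (ltnSn n)) mulr0 mul0r addr0.
rewrite [RHS]big_ord_recl /= !bin0 !subn0; congr (_ + _).
  by rewrite exprSr; ring.
apply: eq_bigr => i _; rewrite /bump leq0n add1n.
by rewrite -[(n - i)%N]prednK ?subn_gt0 // -subnS exprSr; ring.
Qed.

Section WhitneyOperator.
Variables (R : realType) (m r : R).

Definition whitney_op (b : nat -> R) (k : nat) : R :=
  b k.+1 + (m * k%:R + r) * b k.

(** [whitney_op] is the transpose of the recurrence, so each step in [n] passes from the
    coefficients to [b]; hence the induction is for all [b]. *)
Lemma sum_rWhitney2_rec n (b : nat -> R) :
  \sum_(k < n.+1) rWhitney2_rec m r n k * b k = iter n whitney_op b 0.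
Proof.
elim: n b => [|n IH] b; first by rewrite big_ord1 /= mul1r.
rewrite iterSr -IH.
under eq_bigr do rewrite /= mulrDl.
rewrite big_split /= big_ord_recl /= mul0r add0r.
rewrite [X in _ + X]big_ord_recr /= rWhitney2_rec_gt // mulr0 mul0r addr0.
rewrite -big_split; apply: eq_bigr => k _ /=.
by rewrite /bump leq0n add1n /whitney_op; ring.
Qed.

Lemma iter_whitney_op_shift n (b : nat -> R) k j :
  iter n whitney_op b (k + j)
  = \sum_(i < n.+1) (m * k%:R) ^+ (n - i) * 'C(n, i)%:R
      * iter i whitney_op (fun j' => b (k + j')%N) j.
Proof.
elim: n j => [|n IH] j; first by rewrite big_ord1 /= !mul1r.
rewrite (binomial_sumS _ (fun i => iter i whitney_op _ j)).
rewrite iterS {1}/whitney_op -addnS !IH mulr_sumr -big_split.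
(* The factor [m * (k + j) + r] splits into [m * j + r], which belongs to [whitney_op] at [j], and
   the scalar [m * k]. *)
by apply: eq_bigr => i _ /=; rewrite /whitney_op natrD; ring.
Qed.

Variable W : nat -> nat -> R.
Hypotheses (m_neq0 : m != 0) (hW : is_rWhitney2 m r W).

(** Only the values with [k <= n] enter, and there uniqueness identifies [W] with the recursive
    family. *)
Lemma sum_rWhitney2 n (b : nat -> R) :
  \sum_(k < n.+1) W n k * b k = iter n whitney_op b 0.
Proof.
rewrite -sum_rWhitney2_rec; apply: eq_bigr => k _; congr (_ * _).
by apply: (is_rWhitney2_unique m_neq0 hW (is_rWhitney2_exists m r)); rewrite -ltnS.
Qed.

Lemma sum_rWhitney2_add l n (b : nat -> R) :
  \sum_(k < (l + n).+1) W (l + n) k * b k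
  = \sum_(k < l.+1) \sum_(i < n.+1)
      (m * k%:R) ^+ (n - i) * 'C(n, i)%:R * W l k
      * \sum_(j < i.+1) W i j * b (k + j)%N.
Proof.
rewrite sum_rWhitney2 iterD -sum_rWhitney2; apply: eq_bigr => k _.
(* Index [k] is read as [k + 0], so that shifting by [k] leaves values at 0, which are again sums
   against [W i]. *)
rewrite -[X in iter _ _ _ X]addn0 iter_whitney_op_shift mulr_sumr.
apply: eq_bigr => i _.
by rewrite (sum_rWhitney2 i (fun j => b (k + j)%N)); ring.
Qed.

End WhitneyOperator.

Theorem theorem10 (R : realType) (m r : R) (W : nat -> nat -> R)
    (hm : m != 0) (hW : is_rWhitney2 m r W) (l n : nat) :
  (forall x y : R,
     rDowling_poly W (l + n) x y
     = \sum_(k < l.+1) \sum_(i < n.+1)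
         (m * k%:R) ^+ (n - i) * 'C(n, i)%:R * W l k
         * rDowling_poly W i (x - k%:R) y * falling x k * y ^+ k)
  /\
  rDowling W (l + n)
  = \sum_(k < l.+1) \sum_(i < n.+1)
      (m * k%:R) ^+ (n - i) * 'C(n, i)%:R * W l k * rDowling W i.
Proof.
split=> [x y|].
  rewrite /rDowling_poly; under eq_bigr do rewrite -mulrA.
  rewrite (sum_rWhitney2_add hm hW l n (fun k => falling x k * y ^+ k)).
  apply: eq_bigr => k _; apply: eq_bigr => i _.
  rewrite -!mulrA; do 3!congr (_ * _).
  (* Splitting [(x)_(k+j)] as [(x)_k (x-k)_j] is what produces the argument [x - k]. *)
  rewrite mulr_suml; apply: eq_bigr => j _.
  by rewrite falling_add exprD; ring.
(* The constant sequence 1 is shift-invariant, so the inner sums do not depend on [k]. *)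
have sumW1 p : rDowling W p = \sum_(k < p.+1) W p k * 1.
  by apply: eq_bigr => k _; rewrite mulr1.
rewrite sumW1 (sum_rWhitney2_add hm hW l n (fun=> 1)).
by apply: eq_bigr => k _; apply: eq_bigr => i _; rewrite sumW1.
Qed.
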